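(* Let $m,n$ be positive integers. The function $g: H'_{m,n}\to H_m\otimes H_n$ given by $$g(A,B) = i\,f(U_A^*,-U_B)^{-1}f(U_A^*,U_B) = i\,f(-U_A,U_B^* )^{-1}f(U_A,U_B^* )$$ is well defined (the indicated inverses exist, the two expressions agree, and the values lie in $H_m\otimes H_n$), and it is the unique function $H'_{m,n}\to H_m\otimes H_n$ satisfying $$U_{g(A,B)} = U_A\otimes U_B\qquad\text{for all } (A,B)\in H'_{m,n}.$$
   Context: $M_n$ denotes the algebra of $n\times n$ complex matrices, $H_n\subset M_n$ the set of Hermitian matrices, $I_n$ the $n\times n$ identity matrix, $A^*$ the conjugate transpose of $A$, and $\otimes$ the Kronecker product. $H_m\otimes H_n$ is the real tensor product, i.e. the real span of the matrices $A\otimes B$ with $A\in H_m$, $B\in H_n$, which is the set of Hermitian $mn\times mn$ matrices. For a Hermitian matrix $A\in H_k$ (any $k$), the Cayley transform of $A$ is the unitary matrix $U_A=(A-iI_k)(A+iI_k)^{-1}$. For $X\in M_m$, $Y\in M_n$, the Kronecker sum is $f(X,Y)=X\otimes I_n+I_m\otimes Y$. Finally, $$H'_{m,n}=\{(A,B)\in H_m\times H_n : U_A\otimes U_B \text{ does not have } 1 \text{ as an eigenvalue}\}.$$ *)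

(* Defs.v *)
From mathcomp Require Import all_boot all_order all_algebra.
From mathcomp Require Import complex mxtens.
From mathcomp Require Import boolp classical_sets reals.

Set Implicit Arguments.
Unset Strict Implicit.
Unset Printing Implicit Defensive.

Import Order.TTheory GRing.Theory Num.Theory.

Local Open Scope ring_scope.
Local Open Scope complex_scope.
Local Open Scope sesquilinear_scope.
Local Open Scope classical_set_scope.

(* [invmx] is total (it is the identity on singular matrices), so the
   invertibility of [A + i I] for Hermitian [A] is not part of the definition.
   ['i] is here the concrete element [0 +i* 1] of [R[i]]. *)
Definition cayley (R : realType) (k : nat) (A : 'M[R[i]]_k) : 'M[R[i]]_k :=
  (A - ('i%C)%:M) *m invmx (A + ('i%C)%:M).

Definition ksum (R : realType) (m n : nat) (X : 'M[R[i]]_m) (Y : 'M[R[i]]_n) :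
    'M[R[i]]_(m * n) :=
  X *t (1%:M : 'M_n) + (1%:M : 'M_m) *t Y.

(* The real span of the Kronecker products of Hermitian matrices. *)
Definition herm_tens (R : realType) (m n : nat) : set 'M[R[i]]_(m * n) :=
  [set M | exists (k : nat) (c : 'I_k -> R)
                  (A : 'I_k -> 'M[R[i]]_m) (B : 'I_k -> 'M[R[i]]_n),
     (forall j, A j \is hermsymmx /\ B j \is hermsymmx) /\
     M = \sum_(j < k) (c j)%:C *: (A j *t B j)].

Definition cayley_dom (R : realType) (m n : nat) :
    set ('M[R[i]]_m * 'M[R[i]]_n) :=
  [set AB | [/\ AB.1 \is hermsymmx, AB.2 \is hermsymmx &
                ~~ eigenvalue (cayley AB.1 *t cayley AB.2) 1]].

Definition g_left (R : realType) (m n : nat) (A : 'M[R[i]]_m) (B : 'M[R[i]]_n) :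
    'M[R[i]]_(m * n) :=
  'i%C *: (invmx (ksum ((cayley A)^t*) (- cayley B))
             *m ksum ((cayley A)^t*) (cayley B)).

Definition g_right (R : realType) (m n : nat) (A : 'M[R[i]]_m) (B : 'M[R[i]]_n) :
    'M[R[i]]_(m * n) :=
  'i%C *: (invmx (ksum (- cayley A) ((cayley B)^t*))
             *m ksum (cayley A) ((cayley B)^t*)).

(* Main.v *)
Require Import Defs.
From mathcomp Require Import all_boot all_order all_algebra.
From mathcomp Require Import complex mxtens.
From mathcomp Require Import boolp classical_sets reals.
From mathcomp Require Import ring.

Set Implicit Arguments.
Unset Strict Implicit.
Unset Printing Implicit Defensive.

Import Order.TTheory GRing.Theory Num.Theory.

Local Open Scope ring_scope.
Local Open Scope complex_scope.
Local Open Scope sesquilinear_scope.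
Local Open Scope classical_set_scope.

(** Write [U = U_A], [V = U_B] and [W = U (x) V], a unitary matrix such that
    [1 - W] is invertible.  Since [U^* U = 1],
    [f(U^*, -V) = (U^* (x) 1) (1 - W)] and [f(U^*, V) = (U^* (x) 1) (1 + W)],
    so that [i f(U^*, -V)^-1 f(U^*, V) = i (1 - W)^-1 (1 + W)], the inverse
    Cayley transform of [W]; factoring out [1 (x) V^*] gives the same value for
    the second expression.  This matrix is Hermitian because [W] is unitary,
    and it is the only Hermitian matrix whose Cayley transform is [W].  Finally,
    by polarization, every Hermitian matrix is a real combination of Kronecker
    products of Hermitian ones. *)

(** * Kronecker products: bilinearity, identity, matrix units *)

Section TensorProduct.
Variable K : comPzRingType.

Lemma tensmxDl m n p q (A B : 'M[K]_(m, n)) (D : 'M[K]_(p, q)) :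
  (A + B) *t D = A *t D + B *t D.
Proof. by apply/matrixP=> i j; rewrite !mxE mulrDl. Qed.

Lemma tensmxDr m n p q (A : 'M[K]_(m, n)) (B D : 'M[K]_(p, q)) :
  A *t (B + D) = A *t B + A *t D.
Proof. by apply/matrixP=> i j; rewrite !mxE mulrDr. Qed.

Lemma tensmxZl m n p q a (A : 'M[K]_(m, n)) (D : 'M[K]_(p, q)) :
  (a *: A) *t D = a *: (A *t D).
Proof. by apply/matrixP=> i j; rewrite !mxE mulrA. Qed.

Lemma tensmxZr m n p q a (A : 'M[K]_(m, n)) (D : 'M[K]_(p, q)) :
  A *t (a *: D) = a *: (A *t D).
Proof. by apply/matrixP=> i j; rewrite !mxE mulrCA. Qed.

Lemma tensmxNl m n p q (A : 'M[K]_(m, n)) (D : 'M[K]_(p, q)) :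
  (- A) *t D = - (A *t D).
Proof. by apply/matrixP=> i j; rewrite !mxE mulNr. Qed.

Lemma tensmxNr m n p q (A : 'M[K]_(m, n)) (D : 'M[K]_(p, q)) :
  A *t (- D) = - (A *t D).
Proof. by apply/matrixP=> i j; rewrite !mxE mulrN. Qed.

Lemma tens1mx1 m n : (1%:M : 'M[K]_m) *t (1%:M : 'M[K]_n) = 1%:M.
Proof.
apply/matrixP=> i j; case: (mxtens_indexP i) => a b.
case: (mxtens_indexP j) => c d; rewrite tensmxE !mxE -natrM mulnb.
by rewrite (can_eq (@mxtens_indexK m n)) xpair_eqE.
Qed.

(** Pairing of indices is injective, so the two coordinate tests multiply into one. This lets
    [herm_tensP] split every matrix unit into a Kronecker product. *)
Lemma delta_tens m n p q (i : 'I_m) (j : 'I_n) (k : 'I_p) (l : 'I_q) :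
  (delta_mx i j *t delta_mx k l : 'M[K]__)
    = delta_mx (mxtens_index (i, k)) (mxtens_index (j, l)).
Proof.
apply/matrixP=> a b; case: (mxtens_indexP a) => a1 a2.
case: (mxtens_indexP b) => b1 b2; rewrite tensmxE !mxE -natrM mulnb.
by rewrite !(can_eq (@mxtens_indexK _ _)) !xpair_eqE andbACA.
Qed.

End TensorProduct.

(** * Conjugate transposes, Hermitian and unitary matrices *)

Section Adjoint.
Variable C : numClosedFieldType.

Lemma adjmxD m n (A B : 'M[C]_(m, n)) : (A + B)^t* = A^t* + B^t*.
Proof. by rewrite linearD map_mxD. Qed.

Lemma adjmxN m n (A : 'M[C]_(m, n)) : (- A)^t* = - A^t*.
Proof. by rewrite linearN map_mxN. Qed.

Lemma adjmxZ m n a (A : 'M[C]_(m, n)) : (a *: A)^t* = a^* *: A^t*.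
Proof. by rewrite linearZ map_mxZ. Qed.

Lemma adjmxM m n p (A : 'M[C]_(m, n)) (B : 'M[C]_(n, p)) :
  (A *m B)^t* = B^t* *m A^t*.
Proof. by rewrite trmx_mul map_mxM. Qed.

Lemma adjmx_scalar n a : (a%:M : 'M[C]_n)^t* = (a^*)%:M.
Proof. by rewrite tr_scalar_mx map_scalar_mx. Qed.

Lemma adjmx_tens m n p q (A : 'M[C]_(m, n)) (B : 'M[C]_(p, q)) :
  (A *t B)^t* = A^t* *t B^t*.
Proof. by rewrite trmx_tens map_mxT. Qed.

Lemma adjmx_sum m n I (r : seq I) (F : I -> 'M[C]_(m, n)) :
  (\sum_(i <- r) F i)^t* = \sum_(i <- r) (F i)^t*.
Proof. by rewrite linear_sum map_mx_sum. Qed.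

Lemma hermsymmxP n (A : 'M[C]_n) : reflect (A^t* = A) (A \is hermsymmx).
Proof.
by rewrite is_hermitianmxE expr0 scale1r eq_sym; apply: eqP.
Qed.

(** The single entry of [v *m v^t*] is a sum of nonnegative squared moduli, so each of them
    vanishes. *)
Lemma mulmx_adj_eq0 n (v : 'rV[C]_n) : v *m v^t* = 0 -> v = 0.
Proof.
move=> /matrixP/(_ 0 0); rewrite !mxE => /psumr_eq0P h.
apply/rowP=> j; rewrite mxE; apply/eqP; rewrite -mul_conjC_eq0.
have := h _ j isT; rewrite !mxE => -> // k _.
by rewrite !mxE mul_conjC_ge0.
Qed.

(* [v A v^*] is real for every row [v], while [v A = - 'i v] makes it
   [- 'i |v|^2]. *)
Lemma herm_addi_unitmx n (A : 'M[C]_n) :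
  A \is hermsymmx -> A + 'i%:M \in unitmx.
Proof.
move=> /hermsymmxP hA; rewrite -row_free_unit -kermx_eq0.
apply/eqP/row_matrixP=> r; rewrite row0; set v := row r _.
have: v *m (A + 'i%:M) = 0 by rewrite -row_mul mulmx_ker row0.
rewrite mulmxDr mul_mx_scalar => /eqP; rewrite addr_eq0 => /eqP vA.
have E1 : v *m A *m v^t* = - ('i *: (v *m v^t*)).
  by rewrite vA mulNmx -scalemxAl.
have E2 : v *m A *m v^t* = 'i *: (v *m v^t*).
  have <- : (v *m A *m v^t*)^t* = v *m A *m v^t*.
    by rewrite !adjmxM trmxCK hA mulmxA.
  by rewrite E1 adjmxN adjmxZ adjmxM trmxCK conjCi scaleNr opprK.
apply: mulmx_adj_eq0; apply/eqP; move: E2; rewrite E1 => /eqP.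
rewrite eq_sym -addr_eq0 -mulr2n -scaler_nat scaler_eq0 pnatr_eq0 /=.
by rewrite scaler_eq0 (negPf (neq0Ci _)).
Qed.

Lemma eigenvalue1N_unitmx n (W : 'M[C]_n) :
  ~~ eigenvalue W 1 -> 1%:M - W \in unitmx.
Proof.
rewrite negbK -opprB -scaleN1r unitmxZ ?unitrN1 // -row_free_unit.
by rewrite -kermx_eq0.
Qed.

Lemma unitarymx1 k : (1%:M : 'M[C]_k) \is unitarymx.
Proof. by apply/unitarymxP; rewrite mul1mx adjmx_scalar conjC1. Qed.

Lemma tens_unitarymx k l (X : 'M[C]_k) (Y : 'M[C]_l) :
  X \is unitarymx -> Y \is unitarymx -> X *t Y \is unitarymx.
Proof.
move=> /unitarymxP XX /unitarymxP YY; apply/unitarymxP.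
by rewrite adjmx_tens tensmx_mul XX YY tens1mx1.
Qed.

(** With [P := A + 'i%:M], this puts the Cayley transform in the form [P^t* *m invmx P]. *)
Lemma herm_subi_adj n (A : 'M[C]_n) :
  A \is hermsymmx -> A - 'i%:M = (A + 'i%:M)^t*.
Proof.
by move=> /hermsymmxP hA; rewrite adjmxD hA adjmx_scalar conjCi raddfN.
Qed.

End Adjoint.

(** * The Cayley transform and its inverse *)

Section Cayley.
Variables (R : realType) (n : nat).

(** Replaces the concrete imaginary unit of [R[i]] by the generic one, to which the lemmas on closed
    fields apply. *)
Lemma cayleyE (A : 'M[R[i]]_n) :
  cayley A = (A - 'i%R%:M) *m invmx (A + 'i%R%:M).
Proof. by rewrite /cayley complexiE. Qed.

Lemma cayley_unitary (A : 'M[R[i]]_n) :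
  A \is hermsymmx -> cayley A \is unitarymx.
Proof.
move=> hA; have uP := herm_addi_unitmx hA.
(* In the order adjoint times matrix, the product has [P *m P^t*] in the middle; commuting these two
   factors lets both cancel against the outer inverses. *)
apply/unitarymxP; rewrite cayleyE; apply: mulmx1C.
rewrite adjmxM (herm_subi_adj hA) trmxCK -(herm_subi_adj hA) mulmxA.
set P := A + _ in uP *.
have comm : P *m (A - 'i%R%:M) = (A - 'i%R%:M) *m P.
  rewrite mulmxDl mulmxBl !mulmxBr !mulmxDr !mul_scalar_mx mul_mx_scalar.
  by rewrite opprD !addrA subrK addrK.
rewrite -(mulmxA _ P) comm mulmxA (herm_subi_adj hA) -adjmxM mulmxV //.
by rewrite adjmx_scalar conjC1 mul1mx mulmxV.
Qed.

Definition inv_cayley (W : 'M[R[i]]_n) :=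
  'i%R *: (invmx (1%:M - W) *m (1%:M + W)).

Variable W : 'M[R[i]]_n.
Hypothesis uW : 1%:M - W \in unitmx.

(** Clearing the denominator, invertible as [H] is Hermitian, leaves a linear equation for [H] with
    coefficient [1%:M - W]. *)
Lemma inv_cayley_unique (H : 'M[R[i]]_n) :
  H \is hermsymmx -> cayley H = W -> H = inv_cayley W.
Proof.
move=> hH /(congr1 (mulmx^~ (H + 'i%R%:M))).
rewrite cayleyE mulmxKV ?herm_addi_unitmx // => E.
have: (1%:M - W) *m H = 'i%R *: (1%:M + W).
  move/eqP: E; rewrite mulmxDr mul_mx_scalar subr_eq => /eqP E.
  rewrite mulmxBl mul1mx [X in X - _]E addrC !addrA addNr add0r.
  by rewrite scalerDr scalemx1 addrC.
by move=> DH; rewrite /inv_cayley scalemxAr -DH mulKmx.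
Qed.

(** Substituting [1 + W = 2 - (1 - W)] leaves [W] only inside the inverse, so that adding or
    subtracting ['i] becomes transparent. *)
Lemma inv_cayleyE : inv_cayley W = ('i%R *+ 2) *: invmx (1%:M - W) - 'i%R%:M.
Proof.
rewrite /inv_cayley.
have -> : 1%:M + W = 2%:R *: 1%:M - (1%:M - W).
  by rewrite scaler_nat mulr2n opprB addrACA subrr addr0.
rewrite mulmxBr -scalemxAr mulmx1 mulVmx // scalerBr scalerA.
by rewrite mulr_natr scalemx1.
Qed.

(** With [E := invmx (1%:M - W)] and [H := inv_cayley W], one has [H + 'i = 2 'i E] and
    [H - 'i = 2 'i (E - 1) = 2 'i W E]. *)
Lemma inv_cayleyK : cayley (inv_cayley W) = W.
Proof.
have comm : W *m invmx (1%:M - W) = invmx (1%:M - W) - 1%:M.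
  by rewrite -{1}[W](subKr 1%:M) mulmxBl mul1mx mulmxV.
rewrite cayleyE inv_cayleyE addrNK -addrA -opprD.
have -> : 'i%R%:M + 'i%R%:M = ('i%R *+ 2) *: (1%:M : 'M[R[i]]_n).
  by rewrite scalemx1 -raddfD -mulr2n.
rewrite -scalerBr -comm scalemxAr mulmxK //.
by rewrite unitmxZ ?unitmx_inv // unitfE mulrn_eq0 (negPf (neq0Ci _)).
Qed.

(* With [E := (1 - W)^-1] the claim reduces to [E + E^* = 1], which follows
   from [(1 - W) (1 - W)^* = (1 - W) + (1 - W)^*]. *)
Lemma inv_cayley_herm : W \is unitarymx -> inv_cayley W \is hermsymmx.
Proof.
move=> /unitarymxP WW; apply/hermsymmxP; rewrite inv_cayleyE.
set D := 1%:M - W; set E := invmx D.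
have DD : D *m D^t* = D + D^t*.
  rewrite /D adjmxD adjmxN adjmx_scalar conjC1 mulmxBl mul1mx mulmxBr WW mulmx1.
  by rewrite opprB [RHS]addrC.
have EE : E^t* = 1%:M - E.
  have ED : D^t* *m E^t* = 1%:M.
    by rewrite -adjmxM mulVmx // adjmx_scalar conjC1.
  have: E *m (D *m D^t*) *m E^t* = 1%:M.
    by rewrite mulmxA mulVmx // mul1mx.
  rewrite DD mulmxDr mulVmx // mulmxDl mul1mx -mulmxA ED mulmx1 => <-.
  by rewrite addrK.
rewrite adjmxD adjmxN adjmxZ adjmx_scalar EE rmorphMn /= conjCi.
rewrite mulNrn scaleNr scalerBr opprB -addrA; congr (_ + _).
by rewrite scalemx1 -!raddfN -raddfD /= opprK mulr2n opprD addrNK.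
Qed.

End Cayley.

(** * The real span of Kronecker products of Hermitian matrices *)

Section HermitianTensors.
Variables (R : realType) (m n : nat).
Implicit Types M N : 'M[R[i]]_(m * n).

Lemma herm_tens_gen (c : R) (A : 'M[R[i]]_m) (B : 'M[R[i]]_n) :
  A \is hermsymmx -> B \is hermsymmx -> herm_tens (c%:C *: (A *t B)).
Proof.
move=> hA hB; exists 1%N, (fun=> c), (fun=> A), (fun=> B); split=> //.
by rewrite big_ord1.
Qed.

Lemma herm_tensD M N : herm_tens M -> herm_tens N -> herm_tens (M + N).
Proof.
move=> [k [c [A [B [hAB ->]]]]] [l [d [A' [B' [hAB' ->]]]]].
pose cat T (f : 'I_k -> T) (g : 'I_l -> T) (j : 'I_(k + l)) :=
  match fintype.split j with inl a => f a | inr b => g b end.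
exists (k + l)%N, (cat _ c d), (cat _ A A'), (cat _ B B'); split.
  by move=> j; rewrite /cat; case: (fintype.split j).
rewrite big_split_ord /cat; congr (_ + _); apply: eq_bigr => j _.
  by rewrite (unsplitK (inl j)).
by rewrite (unsplitK (inr j)).
Qed.

Lemma herm_tens0 : herm_tens (0 : 'M[R[i]]_(m * n)).
Proof.
exists 0%N, (fun=> 0), (fun=> 0), (fun=> 0); split; last by rewrite big_ord0.
by case.
Qed.

Lemma herm_tens_sum I (r : seq I) (F : I -> 'M[R[i]]_(m * n)) :
  (forall i, herm_tens (F i)) -> herm_tens (\sum_(i <- r) F i).
Proof.
move=> hF; apply: big_ind => // [|M N]; first exact: herm_tens0.
exact: herm_tensD.
Qed.

Lemma addadj_herm k (X : 'M[R[i]]_k) : X + X^t* \is hermsymmx.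
Proof. by apply/hermsymmxP; rewrite adjmxD trmxCK addrC. Qed.

Lemma subadj_herm k (X : 'M[R[i]]_k) : 'i%R *: (X - X^t*) \is hermsymmx.
Proof.
apply/hermsymmxP; rewrite adjmxZ adjmxD adjmxN trmxCK conjCi.
by rewrite scaleNr -scalerN opprB.
Qed.

Lemma half_addmx k l (Z : 'M[R[i]]_(k, l)) : (2^-1)%:C *: (Z + Z) = Z.
Proof.
by rewrite -mulr2n -scaler_nat scalerA fmorphV rmorph_nat mulVf
           ?scale1r ?pnatr_eq0.
Qed.

Lemma adjmxZ_real k l (c : R) (Z : 'M[R[i]]_(k, l)) :
  (c%:C *: Z)^t* = c%:C *: Z^t*.
Proof. by rewrite adjmxZ; congr (_ *: _); apply: conjc_real. Qed.

Lemma herm_tens_addadj (X : 'M[R[i]]_m) (Y : 'M[R[i]]_n) :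
  herm_tens (X *t Y + (X *t Y)^t*).
Proof.
(* The real part of a product is the product of the real parts minus the
   product of the imaginary parts. *)
have -> : X *t Y + (X *t Y)^t* =
    (2^-1)%:C *: ((X + X^t*) *t (Y + Y^t*))
    + (- 2^-1)%:C *: (('i%R *: (X - X^t*)) *t ('i%R *: (Y - Y^t*))).
  rewrite tensmxZl tensmxZr !scalerA -expr2 sqrCi mulrN1 -rmorphN opprK.
  rewrite -scalerDr adjmx_tens -[LHS]half_addmx; congr (_ *: _).
  by apply/matrixP=> p q; rewrite !mxE; ring.
by apply: herm_tensD; apply: herm_tens_gen;
  rewrite ?addadj_herm ?subadj_herm.
Qed.

Lemma herm_tensP M : herm_tens M <-> M \is hermsymmx.
Proof.
split.
  move=> [k [c [A [B [hAB ->]]]]]; apply/hermsymmxP.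
  rewrite adjmx_sum; apply: eq_bigr => j _.
  have [/hermsymmxP hA /hermsymmxP hB] := hAB j.
  by rewrite adjmxZ_real adjmx_tens hA hB.
move=> /hermsymmxP hM.
(* Symmetrizing before expanding in matrix units pairs each term with its adjoint; the complex
   coefficient is then absorbed into the left tensor factor. *)
have -> : M = (2^-1)%:C *: M + ((2^-1)%:C *: M)^t*.
  by rewrite adjmxZ_real hM -scalerDr half_addmx.
rewrite [_ *: M]matrix_sum_delta adjmx_sum -big_split /=.
apply: herm_tens_sum => p; rewrite adjmx_sum -big_split /=.
apply: herm_tens_sum => q; case: (mxtens_indexP p) => i k.
case: (mxtens_indexP q) => j l.
by rewrite -delta_tens -tensmxZl; apply: herm_tens_addadj.
Qed.

End HermitianTensors.

(** * Factorization of Kronecker sums *)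

Lemma invmxM_mulmx (F : fieldType) k l (P D : 'M[F]_k) (E : 'M[F]_(k, l)) :
  P \in unitmx -> D \in unitmx ->
  invmx (P *m D) *m (P *m E) = invmx D *m E.
Proof.
move=> uP uD; rewrite -{1}[E](mulKVmx uD) (mulmxA P) mulKmx //.
by rewrite unitmx_mul uP.
Qed.

Section KroneckerSum.
Variables (R : realType) (m n : nat) (U : 'M[R[i]]_m) (V : 'M[R[i]]_n).

(** By the mixed product rule, the left factor turns [U *t V] into [1%:M *t V]. Here [V] is
    arbitrary, so that [- cayley B] can be substituted for it. *)
Lemma ksum_adjl : U \is unitarymx ->
  ksum (U^t*) V = (U^t* *t 1%:M) *m (1%:M + U *t V).
Proof.
move=> /unitarymxP/mulmx1C uU.
by rewrite /ksum mulmxDr mulmx1 tensmx_mul uU mul1mx.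
Qed.

Lemma ksum_adjr : V \is unitarymx ->
  ksum U (V^t*) = (1%:M *t V^t*) *m (1%:M + U *t V).
Proof.
move=> /unitarymxP/mulmx1C uV.
by rewrite /ksum mulmxDr mulmx1 tensmx_mul uV mul1mx addrC.
Qed.

End KroneckerSum.

(** * The two formulas for [g] on its domain *)

Section CayleyDomain.
Variables (R : realType) (m n : nat) (A : 'M[R[i]]_m) (B : 'M[R[i]]_n).
Hypothesis domAB : cayley_dom (A, B).
Let W := cayley A *t cayley B.

Lemma cayley_dom_unitaryl : cayley A \is unitarymx.
Proof. by case: domAB => hA _ _; exact: cayley_unitary. Qed.

Lemma cayley_dom_unitaryr : cayley B \is unitarymx.
Proof. by case: domAB => _ hB _; exact: cayley_unitary. Qed.

Lemma cayley_dom_unitmx : 1%:M - W \in unitmx.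
Proof. by case: domAB => _ _; apply: eigenvalue1N_unitmx. Qed.

Lemma adjl_unitmx : (cayley A)^t* *t (1%:M : 'M_n) \in unitmx.
Proof.
apply/unitarymx_unit/tens_unitarymx; last exact: unitarymx1.
by rewrite trmxC_unitary; exact: cayley_dom_unitaryl.
Qed.

Lemma adjr_unitmx : (1%:M : 'M_m) *t (cayley B)^t* \in unitmx.
Proof.
apply/unitarymx_unit/tens_unitarymx; first exact: unitarymx1.
by rewrite trmxC_unitary; exact: cayley_dom_unitaryr.
Qed.

Lemma ksum_adjlN :
  ksum ((cayley A)^t*) (- cayley B)
    = ((cayley A)^t* *t 1%:M) *m (1%:M - W).
Proof. by rewrite (ksum_adjl _ cayley_dom_unitaryl) tensmxNr. Qed.

Lemma ksum_adjrN :
  ksum (- cayley A) ((cayley B)^t*)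
    = (1%:M *t (cayley B)^t*) *m (1%:M - W).
Proof. by rewrite (ksum_adjr _ cayley_dom_unitaryr) tensmxNl. Qed.

Lemma g_leftE : g_left A B = inv_cayley W.
Proof.
rewrite /g_left complexiE ksum_adjlN (ksum_adjl _ cayley_dom_unitaryl).
by rewrite (invmxM_mulmx _ adjl_unitmx cayley_dom_unitmx).
Qed.

Lemma g_rightE : g_right A B = inv_cayley W.
Proof.
rewrite /g_right complexiE ksum_adjrN (ksum_adjr _ cayley_dom_unitaryr).
by rewrite (invmxM_mulmx _ adjr_unitmx cayley_dom_unitmx).
Qed.

Lemma g_left_herm : herm_tens (g_left A B).
Proof.
rewrite g_leftE; apply/herm_tensP/inv_cayley_herm.
  exact: cayley_dom_unitmx.
exact: tens_unitarymx cayley_dom_unitaryl cayley_dom_unitaryr.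
Qed.

Lemma cayley_g_left : cayley (g_left A B) = W.
Proof. by rewrite g_leftE (inv_cayleyK cayley_dom_unitmx). Qed.

End CayleyDomain.

Theorem theorem2p1 (R : realType) (m n : nat) (hm : (0 < m)%N) (hn : (0 < n)%N) :
  (forall (A : 'M[R[i]]_m) (B : 'M[R[i]]_n), cayley_dom (A, B) ->
     [/\ ksum ((cayley A)^t*) (- cayley B) \in unitmx,
         ksum (- cayley A) ((cayley B)^t*) \in unitmx,
         g_left A B = g_right A B
       & herm_tens (g_left A B)]) /\
  (exists g : @cayley_dom R m n -> @herm_tens R m n,
     (forall AB : @cayley_dom R m n,
        val (g AB) = g_left (val AB).1 (val AB).2) /\
     unique
       (fun h : @cayley_dom R m n -> @herm_tens R m n =>
          forall AB : @cayley_dom R m n,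
            cayley (val (h AB)) = cayley (val AB).1 *t cayley (val AB).2)
       g).
Proof.
split.
  move=> A B domAB; split.
  - rewrite (ksum_adjlN domAB) unitmx_mul (adjl_unitmx domAB).
    exact: cayley_dom_unitmx.
  - rewrite (ksum_adjrN domAB) unitmx_mul (adjr_unitmx domAB).
    exact: cayley_dom_unitmx.
  - by rewrite (g_leftE domAB) (g_rightE domAB).
  - exact: g_left_herm.
have dom (AB : @cayley_dom R m n) : cayley_dom ((val AB).1, (val AB).2).
  by case: AB => -[A B] /= /set_mem.
exists (fun AB => SigSub (mem_set (g_left_herm (dom AB)))); split=> //.
split=> [AB|h hP] /=; first exact: (cayley_g_left (dom AB)).
(* Pointwise, the value of [h] is Hermitian by [herm_tensP] and has the prescribed Cayley transform,
   hence is the inverse Cayley transform. *)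
apply/funext=> AB; apply: val_inj => /=; rewrite (g_leftE (dom AB)).
symmetry; apply: (inv_cayley_unique (cayley_dom_unitmx (dom AB))) (hP AB).
by apply/herm_tensP/set_mem/valP.
Qed.
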